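(* Let $(E,\lambda)$ be a connectivity system, $k\geq 1$ an integer, and $\mathcal{P}$ a set of $k$-profiles which all have the same truncation to a $(k-1)$-profile. Let $\Phi$ be a $\leq_A$-maximal strong $k$-pseudoanemone which has a concatenation into a $k$-anemone and distinguishes at least three profiles in $\mathcal{P}$. Then $\Phi$ is $\preccurlyeq_A$-maximal.
   Context: $\mathbb{N}$ contains $0$. A connectivity system is a (possibly infinite) set $E$ with a map $\lambda:2^E\to\mathbb{N}\cup\{\infty\}$ such that for all $A,B\subseteq E$: $\lambda(A)=\lambda(E\setminus A)$, $\lambda(A)+\lambda(B)\geq\lambda(A\cup B)+\lambda(A\cap B)$, and $\lambda$ is limit-closed: if $n\in\mathbb{N}$ and $(A_i)_{i\in I}$ is a (non-empty) chain with respect to inclusion of subsets of $E$ with $\lambda(A_i)\le n$ for all $i$, then $\lambda(\bigcup_{i}A_i)\leq n$. The value $\lambda(A)$ is the order of $A$. Profiles: let $S_l=\{S\subseteq E:\lambda(S)<l\}$. An $l$-profile is a subset $P\subseteq S_l$ such that (i) for every $S\in S_l$, $P$ contains exactly one of $S$ and $E\setminus S$; (ii) if $R,S\in S_l$ with $R\subsetneq S\in P$ then $R\in P$; (iii) if $R,S\in P$ then $E\setminus(R\cup S)\notin P$. The truncation of a $k$-profile $P$ to a $(k-1)$-profile is $P\cap S_{k-1}$. A set $S$ distinguishes two $k$-profiles if one of them contains $S$ and the other contains $E\setminus S$. A cyclic order on a set $I$ is a total strict cyclic order; $]x,y[$ is the set of elements strictly between $x$ and $y$ when going from $x$ to $y$.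 An interval of $I$ is a subset $Y\subseteq I$ such that for all distinct $x,z\in Y$ at least one of $]x,z[$ and $]z,x[$ is contained in $Y$; it is non-trivial if $Y\notin\{\emptyset,I\}$. A $k$-pseudoflower is a partition $(P_i)_{i\in I}$ of $E$ (into non-empty classes, called petals) with a cyclically ordered index set $I$ such that the union of any interval of partition classes has order at most $k-1$; the sets displayed by it are the unions $\bigcup_{i\in I'}P_i$ for non-trivial intervals $I'$ of $I$. A concatenation of a $k$-pseudoflower $(P_i)_{i\in I}$ is a $k$-pseudoflower $(Q_i)_{i\in I'}$ such that for every $i\in I$ there is $f(i)\in I'$ with $P_i\subseteq Q_{f(i)}$, and such that for all intervals $I''$ of $I'$ the set $f^{-1}(I'')$ is an interval of $I$. A $k$-flower is a $k$-pseudoflower with at least four petals in which the union of any non-trivial interval of petals has order exactly $k-1$. A $k$-anemone is a $k$-flower such that all non-trivial unions of petals (unions of a non-empty proper subset of the petals) of concatenations of it with finitely many petals have order $k-1$. A strong $k$-pseudoanemone is a $k$-pseudoflower for which all unions of petals have order at most $k-1$. A $k$-pseudoflower $\Phi$ distinguishes at least three profiles in $\mathcal{P}$ if there are three elements of $\mathcal{P}$ that are pairwise distinguished by sets displayed by $\Phi$. For strong $k$-pseudoanemones $\Phi,\Psi$: $\Phi\leq_A\Psi$ means that the partition of $\Phi$ is coarser than (or equal to) the partition of $\Psi$, irrespective of the cyclic orders; $\Phi\preccurlyeq_A\Psi$ means that any two profiles in $\mathcal{P}$ which can be distinguished by a union of petals of $\Phi$ can be distinguished by a union of petals of $\Psi$.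 Both are pre-orders on the set of strong $k$-pseudoanemones of $(E,\lambda)$; $\Phi$ is maximal in such a pre-order if whenever $\Phi$ is below $\Psi$, also $\Psi$ is below $\Phi$. *)

(* Defs.v *)
From mathcomp Require Import all_boot.
From mathcomp Require Import boolp classical_sets functions cardinality.

Set Implicit Arguments.
Unset Strict Implicit.
Unset Printing Implicit Defensive.

Local Open Scope classical_set_scope.

(* [None] stands for infinity. *)
Definition enat := option nat.

Definition enat_add (x y : enat) : enat :=
  match x, y with
  | Some m, Some n => Some (m + n)
  | _, _ => None
  end.

Definition enat_le (x y : enat) : bool :=
  match x, y with
  | _, None => true
  | None, Some _ => false
  | Some m, Some n => m <= n
  end.

Definition enat_lt (x y : enat) : bool := ~~ enat_le y x.

(* [conn A] is written lambda(A) in the literature, and called the order of A;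
   a chain is given as the set of its members. *)
Record connectivity_system (E : Type) := ConnectivitySystem {
  conn :> set E -> enat;
  conn_sym : forall A, conn A = conn (~` A);
  conn_submod : forall A B,
    enat_le (enat_add (conn (A `|` B)) (conn (A `&` B)))
            (enat_add (conn A) (conn B));
  conn_limit_closed : forall (n : nat) (C : set (set E)),
    C !=set0 -> total_on C (fun A B => A `<=` B) ->
    (forall A, C A -> enat_le (conn A) (Some n)) ->
    enat_le (conn (\bigcup_(A in C) A)) (Some n)
}.

Section Profiles.
Variables (E : Type) (lam : connectivity_system E).

Definition sets_below (l : nat) : set (set E) :=
  [set S | enat_lt (lam S) (Some l)].

Record is_profile (l : nat) (P : set (set E)) : Prop := IsProfile {
  profile_sub : P `<=` sets_below l;
  profile_exactly_one : forall S, sets_below l S ->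
    (P S \/ P (~` S)) /\ ~ (P S /\ P (~` S));
  profile_down : forall R S, sets_below l R -> sets_below l S ->
    R `<` S -> P S -> P R;
  profile_union : forall R S, P R -> P S -> ~ P (~` (R `|` S))
}.

Definition truncation (l : nat) (P : set (set E)) : set (set E) :=
  P `&` sets_below l.

Definition distinguishes (S : set E) (P Q : set (set E)) : Prop :=
  (P S /\ Q (~` S)) \/ (Q S /\ P (~` S)).

End Profiles.

(* [R x y z]: going from x to z, one passes through y. Irreflexivity in all
   arguments follows from cyclicity and asymmetry. *)
Record is_cyclic_order (I : Type) (R : I -> I -> I -> Prop) : Prop :=
  IsCyclicOrder {
    cyc_cyclic : forall x y z, R x y z -> R y z x;
    cyc_asym : forall x y z, R x y z -> ~ R z y x;
    cyc_trans : forall x y z w, R x y z -> R x z w -> R x y w;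
    cyc_total : forall x y z, x <> y -> y <> z -> z <> x ->
      R x y z \/ R z y x
  }.

Section Intervals.
Variables (I : Type) (R : I -> I -> I -> Prop).

Definition cyc_between (x y : I) : set I := [set z | R x z y].

Definition cyc_interval (Y : set I) : Prop :=
  forall x z, Y x -> Y z -> x <> z ->
    cyc_between x z `<=` Y \/ cyc_between z x `<=` Y.

End Intervals.

Definition nontrivial_subset (I : Type) (Y : set I) : Prop :=
  Y <> set0 /\ Y <> setT.

Record pseudoflower (E : Type) (lam : connectivity_system E) (k : nat) :=
  Pseudoflower {
    petal_index : Type;
    cyc : petal_index -> petal_index -> petal_index -> Prop;
    petal : petal_index -> set E;
    cyc_is_cyclic_order : is_cyclic_order cyc;
    petal_nonempty : forall i, petal i !=set0;
    petal_disjoint : trivIset setT petal;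
    petal_cover : \bigcup_i petal i = setT;
    interval_order : forall Y : set petal_index, cyc_interval cyc Y ->
      enat_le (lam (\bigcup_(i in Y) petal i)) (Some k.-1)
  }.

Section Pseudoflowers.
Variables (E : Type) (lam : connectivity_system E) (k : nat).
Implicit Types Phi Psi : pseudoflower lam k.

Definition petal_union Phi (Y : set (petal_index Phi)) : set E :=
  \bigcup_(i in Y) petal i.

Definition is_petal_union Phi (S : set E) : Prop :=
  exists Y : set (petal_index Phi), S = petal_union Y.

Definition displayed Phi (S : set E) : Prop :=
  exists Y : set (petal_index Phi),
    [/\ cyc_interval (@cyc _ _ _ Phi) Y, nontrivial_subset Y
      & S = petal_union Y].

(* Psi is a concatenation of Phi. *)
Definition concatenation Phi Psi : Prop :=
  exists f : petal_index Phi -> petal_index Psi,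
    (forall i, petal i `<=` petal (f i)) /\
    (forall Y : set (petal_index Psi), cyc_interval (@cyc _ _ _ Psi) Y ->
       cyc_interval (@cyc _ _ _ Phi) (f @^-1` Y)).

Definition is_flower Phi : Prop :=
  (`I_4 #<= [set: petal_index Phi])%card /\
  (forall Y : set (petal_index Phi), cyc_interval (@cyc _ _ _ Phi) Y ->
     nontrivial_subset Y -> lam (petal_union Y) = Some k.-1).

Definition is_anemone Phi : Prop :=
  is_flower Phi /\
  (forall Psi, concatenation Phi Psi -> finite_set [set: petal_index Psi] ->
     forall Y : set (petal_index Psi), nontrivial_subset Y ->
       lam (petal_union Y) = Some k.-1).

Definition is_strong_pseudoanemone Phi : Prop :=
  forall Y : set (petal_index Phi), enat_le (lam (petal_union Y)) (Some k.-1).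

Definition distinguishes_three (PP : set (set (set E))) Phi : Prop :=
  exists P1 P2 P3 : set (set E),
    [/\ PP P1, PP P2 & PP P3] /\
    [/\ exists2 S, displayed Phi S & distinguishes S P1 P2,
        exists2 S, displayed Phi S & distinguishes S P1 P3
      & exists2 S, displayed Phi S & distinguishes S P2 P3].

(* The partition of Phi is coarser than (or equal to) that of Psi. *)
Definition le_A Phi Psi : Prop :=
  forall j : petal_index Psi, exists i : petal_index Phi, petal j `<=` petal i.

Definition preceq_A (PP : set (set (set E))) Phi Psi : Prop :=
  forall P Q : set (set E), PP P -> PP Q ->
    (exists2 S, is_petal_union Phi S & distinguishes S P Q) ->
    exists2 S, is_petal_union Psi S & distinguishes S P Q.

Definition maximal_strong_pseudoanemone
    (le : pseudoflower lam k -> pseudoflower lam k -> Prop) Phi : Prop :=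
  is_strong_pseudoanemone Phi /\
  (forall Psi, is_strong_pseudoanemone Psi -> le Phi Psi -> le Psi Phi).

End Pseudoflowers.

(* Main.v *)
Require Import Defs.
From mathcomp Require Import all_boot.
From mathcomp Require Import boolp classical_sets functions cardinality.
From mathcomp Require Import wochoice.

(** Membership of a set in a profile reads as smallness: a k-profile P declares
    one side of every set of order at most k-1 small, and the other side big.
    For a strong k-pseudoanemone, every union of petals has such an order, so P
    induces an ultrafilter on the index set of the petals: the index sets whose
    petal union is big.  Profiles in PP have the same truncation, so a set that
    is small for one of them and big for another has order at least k-1; if the
    order is also known to be at most k-1, submodularity becomes an exact
    uncrossing tool.  Call sets low or high when their order is at most,
    respectively at least, k-1.

    Suppose that Psi is a strong k-pseudoanemone above Phi, and that some union
    S of petals of Psi distinguishes profiles P and Q inducing the same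
    ultrafilter p on the petals of Phi.  Among the three profiles distinguished
    by Phi, two, P1 and P2, are distinguished from P by Phi as well.  As Phi is
    below Psi, some union S' of petals of Psi distinguishes P1 from P2, and then
    one of S, S' and their symmetric difference distinguishes both P from Q and
    P1 from P2.  Assume that S does, with S big for P and P2 and small for Q and
    P1.

    The anemone Psi0 obtained from Phi has at least four petals, and each of P,
    P1, P2 finds at most one of them big, so some petal of Psi0 is small for all
    three.  It has order k-1 and it is the union of the petals of Phi indexed by
    a set W.

    Write A(Y) for the union of the petals of Phi indexed by Y, and take Y
    disjoint from W, big for P and small for P1 and P2.  Then the four profiles
    lie in the four corners of the bipartitions given by A(Y) and S in such a
    way that every corner (A(Y) meet S) union A(Z) with Z disjoint from Y is
    low; this is low_corner.  Shrinking Y with Zorn's lemma and limit-closure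
    leads to the same statement for single petals, low_corner_petal: splitting
    one petal A(j) along S refines Phi to a strong k-pseudoanemone.  This holds
    for all j in a set X that is big for P: if p is principal then X consists of
    the generator of p, and otherwise no petal is big for P.  Since Phi is
    maximal, each of these petals lies on one side of S.  Hence A(X) meet S is a
    union of petals of Phi.  It is big for P and small for Q, a
    contradiction. *)

Local Open Scope classical_set_scope.

Set Implicit Arguments.
Unset Strict Implicit.
Unset Printing Implicit Defensive.

Ltac unfold_sets := rewrite /setU /setI /setC /setD /set1 /preimage /mkset /=.

(** * Sets of order at most, or at least, k-1 *)

Definition low (E : Type) (lam : connectivity_system E) (k : nat) (A : set E) :=
  enat_le (lam A) (Some k.-1).

Definition high (E : Type) (lam : connectivity_system E) (k : nat) (A : set E) :=
  enat_le (Some k.-1) (lam A).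

Section Order.
Variables (E : Type) (lam : connectivity_system E) (k : nat).
Implicit Types A B : set E.
Local Notation low := (low lam k).
Local Notation high := (high lam k).

Lemma lowC A : low (~` A) = low A.
Proof. by rewrite /low -conn_sym. Qed.

Lemma highC A : high (~` A) = high A.
Proof. by rewrite /high -conn_sym. Qed.

Lemma low_setI A B : low A -> low B -> high (A `|` B) -> low (A `&` B).
Proof.
rewrite /low /high; have := conn_submod lam A B.
case: (lam A) => [a|//]; case: (lam B) => [b|//].
case: (lam (A `|` B)) => [u|//]; case: (lam (A `&` B)) => [i|//] /=.
move=> h ha hb hu; rewrite -(leq_add2l u); apply: leq_trans h _.
by apply: leq_add => //; apply: leq_trans hu.
Qed.

Lemma low_setU A B : low A -> low B -> high (A `&` B) -> low (A `|` B).
Proof.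
move=> lA lB hI; rewrite -lowC setCU; apply: low_setI; rewrite ?lowC //.
by rewrite -setCI highC.
Qed.

(** Limit-closure speaks of unions; the complements of the members of a chain
    form a chain as well, and [conn] is symmetric. *)
Lemma low_bigcap (C : set (set E)) : C !=set0 -> total_on C subset ->
  (forall A, C A -> low A) -> low (\bigcap_(A in C) A).
Proof.
move=> [A0 CA0] Ctot Clow; rewrite -lowC setC_bigcap.
have -> : \bigcup_(A in C) ~` A = \bigcup_(B in [set ~` A | A in C]) B.
  by rewrite bigcup_image.
apply: conn_limit_closed.
- by exists (~` A0), A0.
- move=> _ _ [A CA <-] [B CB <-].
  by case: (Ctot _ _ CA CB) => /subsetC; [right|left].
- by move=> _ [A CA <-]; have := Clow _ CA; rewrite -lowC.
Qed.

Lemma lowE A : (0 < k)%N -> sets_below lam k A <-> low A.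
Proof.
rewrite /sets_below /= /enat_lt /low; case: k => [//|n] _ /=.
by case: (lam A) => [a|] //=; rewrite -ltnNge ltnS.
Qed.

(** A set of order below k-1 lies in the common truncation and thus cannot
    separate the two profiles.  The premise may assume that the set is low, since
    only then does the profile calculus apply to it. *)
Lemma high_separated (P Q : set (set E)) A :
  truncation lam k.-1 P = truncation lam k.-1 Q ->
  (low A -> P A /\ ~ Q A) -> high A.
Proof.
move=> tr sep; apply/negP => /negP nh.
have lA : low A.
  move: nh; rewrite /high /low; case: (lam A) => [a|] //=.
  by rewrite -ltnNge => /ltnW.
have [PA nQA] := sep lA; apply: nQA.
have : truncation lam k.-1 P A by split.
by rewrite tr => -[].
Qed.

End Order.

(** * Calculus of small sets of a profile *)

Section Profile.
Variables (E : Type) (lam : connectivity_system E) (k : nat).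
Hypothesis k_gt0 : (0 < k)%N.
Variable P : set (set E).
Hypothesis profP : is_profile lam k P.
Implicit Types U V : set E.
Local Notation low := (low lam k).

Lemma profile_setC U : low U -> P (~` U) <-> ~ P U.
Proof.
move=> /(lowE lam U k_gt0)/(profile_exactly_one profP)[h1 h2].
by split=> [PCU PU|nPU]; [apply: h2|case: h1].
Qed.

Lemma profile_subset U V : low U -> U `<=` V -> P V -> P U.
Proof.
move=> lU UV PV; have [->//|UneV] := pselect (U = V).
apply: (profile_down profP (R := U) (S := V)) => //.
- exact/(lowE lam U k_gt0).
- exact: (profile_sub profP).
- by split=> // VU; apply: UneV; apply/seteqP.
Qed.

Lemma profile_setU U V : low (U `|` V) -> P U -> P V -> P (U `|` V).
Proof.
move=> lUV PU PV; apply: contrapT => /(profile_setC lUV).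
exact: (profile_union profP).
Qed.

Lemma profile_setI U V : low U -> low V -> ~ P U -> ~ P V -> ~ P (U `&` V).
Proof.
move=> lU lV /(profile_setC lU) PU /(profile_setC lV) PV.
by have := profile_union profP PU PV; rewrite -setCI setCK.
Qed.

End Profile.

Lemma distinguishesE (E : Type) (lam : connectivity_system E) k S P Q :
  (0 < k)%N -> is_profile lam k P -> is_profile lam k Q -> low lam k S ->
  distinguishes S P Q <-> ~ (P S <-> Q S).
Proof.
move=> k0 pP pQ lS; rewrite /distinguishes.
rewrite (profile_setC k0 pP lS) (profile_setC k0 pQ lS).
by case: (EM (P S)) => ?; case: (EM (Q S)) => ?; tauto.
Qed.

(** * Uncrossing petal unions with a crossing set *)

(** Two profiles P and Q that look alike to the petal map [pi] are cut apart by
    a low set [S] that also cuts apart P1 and P2: [S] is big for P and P2, and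
    small for Q and P1.  The set [W] stands for a flower petal away from all four
    profiles. *)
Record corner_config (E : Type) (lam : connectivity_system E) (k : nat)
    (I : Type) (pi : E -> I) (W : set I) (S : set E)
    (P Q P1 P2 : set (set E)) : Prop := CornerConfig {
  cc_profile : [/\ is_profile lam k P, is_profile lam k Q,
                   is_profile lam k P1 & is_profile lam k P2];
  cc_trunc : truncation lam k.-1 P = truncation lam k.-1 Q /\
    [/\ truncation lam k.-1 P1 = truncation lam k.-1 P,
        truncation lam k.-1 P2 = truncation lam k.-1 P
      & truncation lam k.-1 P1 = truncation lam k.-1 P2];
  cc_low : forall Y, low lam k (pi @^-1` Y);
  cc_agree : forall Y, P (pi @^-1` Y) <-> Q (pi @^-1` Y);
  cc_cross : [/\ ~ P S, Q S, P1 S & ~ P2 S];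
  cc_S_low : low lam k S;
  cc_apart : exists Y, P1 (pi @^-1` Y) /\ ~ P2 (pi @^-1` Y);
  cc_W_high : high lam k (pi @^-1` W);
  cc_W : [/\ P (pi @^-1` W), P1 (pi @^-1` W) & P2 (pi @^-1` W)]
}.

Section Corner.
Variables (E : Type) (lam : connectivity_system E) (k : nat).
Hypothesis k_gt0 : (0 < k)%N.
Variables (I : Type) (pi : E -> I) (W : set I).
Implicit Types (S : set E) (P Q : set (set E)) (X Y Z : set I).
Local Notation low := (low lam k).
Local Notation high := (high lam k).
Local Notation A := (fun Y => pi @^-1` Y).
Local Notation config := (corner_config lam k pi W).

(** Reversing [S] exchanges P with Q and P1 with P2, which halves the case
    analyses below. *)
Lemma corner_config_sym S P Q P1 P2 : config S P Q P1 P2 ->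
  config (~` S) Q P P2 P1.
Proof.
case=> -[pP pQ p1 p2] [tPQ [t1 t2 t12]] lA agr [PS QS P1S P2S] lS [Y [y1 y2]] hW.
case=> wP w1 w2; split=> //.
- by rewrite -tPQ.
- by move=> Z; rewrite agr.
- have := (profile_setC k_gt0 pP lS, profile_setC k_gt0 pQ lS,
           profile_setC k_gt0 p1 lS, profile_setC k_gt0 p2 lS).
  by case=> -[[] ? ? ? ?]; split; tauto.
- by rewrite lowC.
- exists (~` Y); rewrite -preimage_setC.
  by have := (profile_setC k_gt0 p1 (lA Y), profile_setC k_gt0 p2 (lA Y));
    case; tauto.
- by split=> //; rewrite -agr.
Qed.

Definition corner S Y Z := (A Y `&` S) `|` A Z.

(** Sets of petals on which P, Q can be separated by [S] while P1, P2 and the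
    spare high set [W] stay outside. *)
Definition apt P P1 P2 Y :=
  [/\ ~ P (A Y), P1 (A Y), P2 (A Y) & Y `&` W = set0].

Section OneSided.
Variables (S : set E) (P Q P1 P2 : set (set E)).
Hypothesis cfg : config S P Q P1 P2.

Let lA Y : low (A Y). Proof. by case: cfg. Qed.

(** Two uncrossings.  The sets A(Y u Z) and S have a high union, which separates
    P from P1, hence a low intersection.  That intersection meets A(Z) in the
    part of A(Z) inside S, which is high because it separates P2 from P1, so its
    union with A(Z), which is the corner, is low. *)
Lemma low_corner_between Y Z : apt P P1 P2 Y -> P1 (A Z) -> ~ P2 (A Z) ->
  low (corner S Y Z).
Proof.
case: cfg => -[pP pQ p1 p2] [tPQ [t1 t2 t12]] _ agr [PS QS P1S P2S] lS _ _ _.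
move=> [PY Y1 Y2 _] Z1 Z2.
have lI : low (A (Y `|` Z) `&` S).
  apply: low_setI => //; apply: (high_separated t1) => lU; split.
    apply: (profile_setU k_gt0 p1 lU) => //.
    exact: (profile_setU k_gt0 p1 (lA (Y `|` Z))).
  by move=> /(profile_subset k_gt0 pP lS); apply: contra_not PS; apply; right.
have -> : corner S Y Z = (A (Y `|` Z) `&` S) `|` A Z.
  by rewrite predeqE /corner => x; unfold_sets; tauto.
apply: low_setU => //.
have -> : A (Y `|` Z) `&` S `&` A Z = A Z `&` S.
  by rewrite predeqE => x; unfold_sets; tauto.
apply: (high_separated t12) => lU; split.
  by apply: (profile_subset k_gt0 p1 lU) Z1 => x [].
exact: (profile_setI k_gt0 p2).
Qed.

(** Enlarge [Z] by a set outside [Y] that is big for P2 and small for P1, apply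
    the previous lemma, and cut back by intersecting with A(Y u Z); the union of
    the two sets still separates P from P1. *)
Lemma low_corner_avoid Y Z : apt P P1 P2 Y -> P1 (A Z) -> low (corner S Y Z).
Proof.
move=> aY Z1; have [PY Y1 Y2 _] := aY.
case: cfg => -[pP pQ p1 p2] [tPQ [t1 t2 t12]] _ agr _ lS [Y0 [Y01 Y02]] _ _.
pose Z' := Z `|` (Y0 `\` Y).
have Z'1 : P1 (A Z').
  apply: (profile_setU k_gt0 p1 (lA Z')) => //.
  by apply: (profile_subset k_gt0 p1 (lA (Y0 `\` Y))) Y01 => x [].
have Z'2 : ~ P2 (A Z').
  move=> /(profile_subset k_gt0 p2 (lA (Y0 `\` Y))) h.
  have /h : A (Y0 `\` Y) `<=` A Z' by move=> x; right.
  apply: (profile_setI k_gt0 p2 (lA Y0) (lA (~` Y))) => //.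
  by move/(profile_setC k_gt0 p2 (lA Y)).
have -> : corner S Y Z = corner S Y Z' `&` A (Y `|` Z).
  rewrite predeqE /corner /Z' => x; unfold_sets.
  by case: (EM (Y (pi x))); tauto.
apply: low_setI => //; first exact: low_corner_between.
have -> : corner S Y Z' `|` A (Y `|` Z) = A (Y `|` Z').
  by rewrite predeqE /corner /Z' => x; unfold_sets; tauto.
apply: (high_separated t1) => lU; split.
  exact: (profile_setU k_gt0 p1).
by apply: contra_not PY; apply: (profile_subset k_gt0 pP) => // x; left.
Qed.

End OneSided.

Lemma apt_sym S P Q P1 P2 Y : config S P Q P1 P2 ->
  apt P P1 P2 Y -> apt Q P2 P1 Y.
Proof. by case=> _ _ _ agr _ _ _ _ _ [PY Y1 Y2 YW]; split=> //; rewrite -agr. Qed.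

(** The complement of a corner of [S] is a corner of the complement of [S], so
    the symmetry of configurations acts on corners. *)
Lemma corner_setC S Y Z : Y `&` Z = set0 ->
  corner S Y Z = ~` corner (~` S) Y (~` (Y `|` Z)).
Proof.
move=> YZ; rewrite predeqE /corner => x; unfold_sets.
have : ~ (Y `&` Z) (pi x) by rewrite YZ.
unfold_sets.
by case: (EM (Y (pi x))); case: (EM (Z (pi x))); case: (EM (S x)); tauto.
Qed.

Section TwoSided.
Variables (S : set E) (P Q P1 P2 : set (set E)).
Hypothesis cfg : config S P Q P1 P2.

Let lA Y : low (A Y). Proof. by case: cfg. Qed.

(** The mirror image of [low_corner_avoid], read on the complement. *)
Lemma low_corner_contains_P2 Y Z : apt P P1 P2 Y -> Y `&` Z = set0 ->
  ~ P2 (A Z) -> low (corner S Y Z).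
Proof.
move=> aY YZ nZ; rewrite corner_setC // lowC.
have [[_ _ _ p2] _ _ _ _ _ _ _ _] := cfg.
apply: (low_corner_avoid (corner_config_sym cfg) (apt_sym cfg aY)).
rewrite -preimage_setC; apply/(profile_setC k_gt0 p2 (lA _)).
apply: contra_not nZ; apply: (profile_subset k_gt0 p2) => // x; by right.
Qed.

(** The remaining case is that of [Z] big for P1 and small for P2.  Outside [W]
    one may enlarge [Z] to everything avoiding [Y] and [W], which is big for P2,
    and cut back; that step uses that A(W) is high.  The part of [Z] inside [W]
    is small for P1.  The two corners so obtained are glued along A(Y) meet S,
    which is high since it separates P from Q. *)
Lemma low_corner Y Z : apt P P1 P2 Y -> Y `&` Z = set0 -> low (corner S Y Z).
Proof.
move=> aY YZ; have [PY Y1 Y2 YW] := aY.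
case: (cfg) => -[pP pQ p1 p2] [tPQ _] _ agr [PS QS _ _] lS _ hW [wP w1 w2].
have [Z1|nZ1] := EM (P1 (A Z)); first exact: (low_corner_avoid cfg).
have [Z2|nZ2] := EM (P2 (A Z)); last exact: low_corner_contains_P2.
have YZx x : ~ (Y x /\ Z x) by move=> yz; have : (Y `&` Z) x by []; rewrite YZ.
have YWx x : ~ (Y x /\ W x) by move=> yw; have : (Y `&` W) x by []; rewrite YW.
have low_out : low (corner S Y (Z `\` W)).
  pose Z' := ~` (Y `|` W).
  have -> : corner S Y (Z `\` W) = corner S Y Z' `&` A (Y `|` (Z `\` W)).
    rewrite predeqE /corner /Z' => x; unfold_sets.
    by have := YZx (pi x); have := YWx (pi x); case: (EM (Y (pi x))); tauto.
  apply: low_setI => //.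
    apply: low_corner_contains_P2 => //.
      by rewrite predeqE /Z' => x; unfold_sets; tauto.
    rewrite /Z' -preimage_setC => /(profile_setC k_gt0 p2 (lA _)); apply.
    exact: (profile_setU k_gt0 p2 (lA (Y `|` W))).
  have -> : corner S Y Z' `|` A (Y `|` (Z `\` W)) = ~` (A W).
    rewrite predeqE /corner /Z' => x; unfold_sets.
    have := YZx (pi x); have := YWx (pi x).
    by case: (EM (Y (pi x))); case: (EM (W (pi x))); tauto.
  by rewrite highC.
have low_in : low (corner S Y (Z `&` W)).
  apply: (low_corner_avoid cfg) => //.
  by apply: (profile_subset k_gt0 p1 (lA (Z `&` W))) w1 => x [].
have -> : corner S Y Z = corner S Y (Z `\` W) `|` corner S Y (Z `&` W).
  rewrite predeqE /corner => x; unfold_sets.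
  by case: (EM (W (pi x))); tauto.
apply: low_setU => //.
have -> : corner S Y (Z `\` W) `&` corner S Y (Z `&` W) = A Y `&` S.
  by rewrite predeqE /corner => x; unfold_sets; tauto.
apply: (high_separated (esym tPQ)) => lU; split.
  by apply: (profile_subset k_gt0 pQ lU) QS => x [].
exact: (profile_setI k_gt0 pP).
Qed.

End TwoSided.

(** The corners to which [low_corner] applies have a [Y] that is big for P, and
    when no single petal other than [j] is big for P such sets [Y] can avoid any
    petal but [j].  By limit-closure and Zorn's lemma there is a maximal set [N]
    of indices that can be removed from the initial set while keeping the corner
    low.  Intersecting with a corner that avoids a further petal [i] then
    removes [i] too, because the union of both corners separates P from Q. *)
Lemma low_corner_petal_avoid S P Q P1 P2 X j Z : config S P Q P1 P2 ->
  apt P P1 P2 X -> X j -> ~ Z j -> P (A Z) ->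
  (forall i, i <> j -> P (A [set i])) -> low (corner S [set j] Z).
Proof.
move=> cfg aX Xj nZj PZ Pi; have [PX X1 X2 XW] := aX.
case: (cfg) => -[pP pQ p1 p2] [tPQ _] lA agr [PS QS _ _] lS _ _ _.
pose X' := X `\` Z.
have apt_sub Y : Y `<=` X' -> ~ P (A Y) -> apt P P1 P2 Y.
  move=> YX' PY; have YX : Y `<=` X by move=> x /YX'[].
  split=> //.
  - by apply: (profile_subset k_gt0 p1 (lA Y)) X1 => x /YX.
  - by apply: (profile_subset k_gt0 p2 (lA Y)) X2 => x /YX.
  by apply/seteqP; split=> // x [/YX ? ?]; rewrite -XW.
have lc Y : Y `<=` X' -> ~ P (A Y) -> low (corner S Y Z).
  move=> YX' PY; apply: (low_corner cfg); first exact: apt_sub.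
  by apply/seteqP; split=> // x [/YX'[]].
have bigI Y V : ~ P (A Y) -> P (A V) -> ~ P (A (Y `\` V)).
  move=> PY PV; apply: (profile_setI k_gt0 pP (lA Y) (lA (~` V))) => //.
  by move=> /(profile_setC k_gt0 pP (lA V)).
have PX' : ~ P (A X') by exact: bigI.
pose removable N := ~ N j /\ low (corner S (X' `\` N) Z).
have [|N [[nNj lN] maxN]] := @Zorn_bigcup I removable.
  move=> F FR Ftot; have [->|/eqP/set0P[N0 FN0]] := EM (F = set0).
    by rewrite bigcup_set0; split=> //; rewrite setD0; apply: lc.
  split; first by move=> [N /FR[]].
  have -> : corner S (X' `\` \bigcup_(N in F) N) Z =
      \bigcap_(B in [set corner S (X' `\` N) Z | N in F]) B.
    rewrite bigcap_image predeqE /corner => x; unfold_sets; split.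
      move=> [[[Xx nN] Sx]|Zx] N FN; [left|by right].
      by split=> //; split=> // Nx; apply: nN; exists N.
    move=> h; have [Zx|nZx] := EM (Z (pi x)); [by right|left].
    have := h _ FN0; unfold_sets => -[[[Xx _] Sx]|//].
    split=> //; split=> // -[N FN Nx].
    by have := h _ FN; unfold_sets; tauto.
  apply: low_bigcap.
  - by exists (corner S (X' `\` N0) Z), N0.
  - move=> _ _ [N FN <-] [M FM <-].
    have sub (N1 N2 : set I) : N1 `<=` N2 ->
        corner S (X' `\` N2) Z `<=` corner S (X' `\` N1) Z.
      move=> N12 x; rewrite /corner; unfold_sets.
      by have := N12 (pi x); tauto.
    by case: (Ftot _ _ FN FM) => /sub; [right|left].
  - by move=> _ [N /FR[_ ?] <-].
suff N_all i : X' i -> i <> j -> N i.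
  have <- : corner S (X' `\` N) Z = corner S [set j] Z; last by [].
  rewrite predeqE /corner => x; unfold_sets.
  have := N_all (pi x); have [->|ne] := EM (pi x = j); last tauto.
  by have : X' j by []; unfold_sets; tauto.
move=> X'i ij; apply: contrapT => nNi.
apply: (maxN (N `|` [set i])).
  by split=> [x|h]; [left|apply: nNi; apply: h; right].
split; first by case=> // ji; apply: ij.
have PXi : ~ P (A (X' `\` [set i])) by apply: bigI => //; apply: Pi.
have -> : corner S (X' `\` (N `|` [set i])) Z =
    corner S (X' `\` N) Z `&` corner S (X' `\` [set i]) Z.
  by rewrite predeqE /corner => x; unfold_sets; tauto.
apply: low_setI => //; first by apply: lc => // x [].
pose V := (X' `\` N) `|` (X' `\` [set i]).
have -> : corner S (X' `\` N) Z `|` corner S (X' `\` [set i]) Z = corner S V Z.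
  by rewrite predeqE /corner /V => x; unfold_sets; tauto.
have VX' : V `<=` X' by move=> x [] [].
have PV : ~ P (A V).
  by apply: contra_not PXi; apply: (profile_subset k_gt0 pP) => // x; right.
(* The corner with an empty Z: only a low set can be shown to be small for Q. *)
have lVS : low (A V `&` S).
  have := lc V VX' PV.
  have := low_corner cfg (apt_sub V VX' PV) (setI0 V).
  by rewrite /corner preimage_set0 setU0.
apply: (high_separated (esym tPQ)) => lU; split.
  apply: (profile_setU k_gt0 pQ lU); last by apply/agr.
  by apply: (profile_subset k_gt0 pQ lVS) QS => x [].
have PVS := profile_setI k_gt0 pP (lA V) lS PV PS.
by apply: contra_not PVS; apply: (profile_subset k_gt0 pP) => // x; left.
Qed.

(** If A(Z) is big for P, then the complement of [Z] and [j] is small for P, and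
    the complementary corner is covered by the previous lemma. *)
Lemma low_corner_petal S P Q P1 P2 X j Z : config S P Q P1 P2 ->
  apt P P1 P2 X -> X j -> ~ Z j ->
  (forall i, i <> j -> P (A [set i])) -> low (corner S [set j] Z).
Proof.
move=> cfg aX Xj nZj Pi.
have [[pP pQ _ _] _ lA agr _ _ _ _ _] := cfg.
have [PZ|nPZ] := EM (P (A Z)); first exact: (low_corner_petal_avoid cfg aX).
have jZ : [set j] `&` Z = set0 by apply/seteqP; split=> // x [-> ].
rewrite corner_setC // lowC.
apply: (low_corner_petal_avoid (corner_config_sym cfg) (apt_sym cfg aX)) => //.
- by move=> nj; apply: nj; left.
- apply/agr; rewrite -preimage_setC; apply/(profile_setC k_gt0 pP (lA _)).
  by apply: contra_not nPZ; apply: (profile_subset k_gt0 pP) => // x; right.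
- by move=> i /Pi/agr.
Qed.

End Corner.

(** * Strong pseudoanemones as maps to an index set *)

(** A strong pseudoanemone is just a partition, but a pseudoflower has to come
    with some cyclic order: close up a well-order of the index type. *)
Lemma cyclic_order_exists (J : Type) :
  exists R : J -> J -> J -> Prop, is_cyclic_order R.
Proof.
have [T ->] : exists T : eqType, J = T by exists {classic J}.
have [L Lwo] := well_ordering_principle T.
have minL (s : seq T) x : x \in s -> exists2 z, z \in s & {in s, forall y, L z y}.
  move=> xs; have [|z [[zs zmin] _]] := Lwo [pred y in s]; first by exists x.
  by exists z.
have Ltot x y : L x y \/ L y x.
  have [|z] := @minL [:: x; y] x; first exact: mem_head.
  by rewrite !inE => /orP[] /eqP-> h; [left|right]; apply: h; rewrite !inE eqxx ?orbT.
have Lanti x y : L x y -> L y x -> x = y.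
  move=> xy yx; have Lrefl z : L z z by case: (Ltot z z).
  have [|z [_ zmin]] := Lwo [pred w in [:: x; y]]; first by exists x; exact: mem_head.
  rewrite -(zmin x) ?(zmin y) //; split=> [|w]; rewrite !inE ?eqxx ?orbT //;
    by case/orP => /eqP->.
have Ltrans x y z : L x y -> L y z -> L x z.
  move=> xy yz; have [|w ws wmin] := @minL [:: x; y; z] x; first exact: mem_head.
  have [wx wy wz] : [/\ L w x, L w y & L w z].
    by split; apply: wmin; rewrite !inE eqxx ?orbT.
  move: ws; rewrite !inE => /or3P[] /eqP ew; subst w => //.
    by rewrite (Lanti _ _ xy wx).
  by rewrite -(Lanti _ _ yz wy).
pose lt x y := L x y /\ x <> y.
have ltt x y z : lt x y -> lt y z -> lt x z.
  move=> [xy nxy] [yz nyz]; split; first exact: Ltrans yz.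
  by move=> xz; subst z; apply: nxy; apply: Lanti.
have ltn x : ~ lt x x by case.
have lttot x y : x <> y -> lt x y \/ lt y x.
  by move=> ne; case: (Ltot x y) => h; [left|right]; split=> // /esym.
exists (fun x y z => [\/ lt x y /\ lt y z, lt y z /\ lt z x | lt z x /\ lt x y]).
have asym x y : lt x y -> lt y x -> False by move=> xy /(ltt _ _ _ xy)/ltn.
split.
- by move=> x y z [] [] *; [apply: Or33|apply: Or31|apply: Or32].
- by move=> x y z [] [h1 h2] [] [h3 h4]; eauto.
- move=> x y z w [] [h1 h2] [] [h3 h4];
    by [apply: Or31; split; eauto|apply: Or32; split; eauto
       |apply: Or33; split; eauto|exfalso; eauto].
- move=> x y z xy yz zx.
  by case: (lttot _ _ xy) => ?; case: (lttot _ _ yz) => ?; case: (lttot _ _ zx) => ?;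
    try (by left; by [apply: Or31|apply: Or32|apply: Or33]);
    right; by [apply: Or31|apply: Or32|apply: Or33].
Qed.

Section PetalMap.
Variables (E : Type) (lam : connectivity_system E) (k : nat).
Implicit Type Phi : pseudoflower lam k.

Lemma petal_exists Phi x : exists i : petal_index Phi, petal i x.
Proof.
have : (\bigcup_i petal (p := Phi) i) x by rewrite petal_cover.
by case=> i _; exists i.
Qed.

Definition petal_of Phi x : petal_index Phi := sval (cid (petal_exists Phi x)).

Lemma petal_ofE Phi x (i : petal_index Phi) : petal i x <-> petal_of Phi x = i.
Proof.
have px : petal (petal_of Phi x) x by exact: (svalP (cid (petal_exists Phi x))).
split=> [ix|<- //].
by apply: (@petal_disjoint _ _ _ Phi) => //; exists x.
Qed.

Lemma petal_unionE Phi (Y : set (petal_index Phi)) :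
  petal_union Y = petal_of Phi @^-1` Y.
Proof.
rewrite predeqE => x; split; first by move=> [i Yi /petal_ofE e]; rewrite /preimage /= e.
by move=> Yx; exists (petal_of Phi x) => //; apply/petal_ofE.
Qed.

(** Maximality in the form in which it is used: [q] is the class map of a
    partition finer than that of [Phi], all of whose unions of classes are
    low. *)
Lemma maximal_not_refinable Phi (J : Type) (q : E -> J) :
  maximal_strong_pseudoanemone (@le_A E lam k) Phi ->
  (forall j, exists x, q x = j) ->
  (forall Y : set J, low lam k (q @^-1` Y)) ->
  (forall x y, q x = q y -> petal_of Phi x = petal_of Phi y) ->
  forall x y, petal_of Phi x = petal_of Phi y -> q x = q y.
Proof.
move=> [_ maxPhi] qsurj qlow qfine x y xy.
have [R Rcyc] := cyclic_order_exists J.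
pose cls j := q @^-1` [set j].
have clsU (Y : set J) : \bigcup_(j in Y) cls j = q @^-1` Y.
  rewrite predeqE => z; split=> [[j Yj zj]|Yz]; last by exists (q z).
  by rewrite /preimage /= zj.
have cls0 j : cls j !=set0 by have [z zj] := qsurj j; exists z.
have clsI : trivIset setT cls by move=> i j _ _ [z [<- <-]].
have clsT : \bigcup_j cls j = setT by rewrite clsU.
have clsL (Y : set J) : cyc_interval R Y ->
    enat_le (lam (\bigcup_(j in Y) cls j)) (Some k.-1).
  by move=> _; rewrite clsU; apply: qlow.
pose Psi := Pseudoflower Rcyc cls0 clsI clsT clsL.
have strongPsi : is_strong_pseudoanemone Psi.
  by move=> Y; rewrite /petal_union /= clsU; apply: qlow.
have lePsi : le_A Phi Psi.
  move=> j; have [z zj] := qsurj j; exists (petal_of Phi z) => w /= wj.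
  by apply/petal_ofE; apply: qfine; rewrite wj zj.
have [i sub] := maxPhi Psi strongPsi lePsi (petal_of Phi x).
have /sub : petal (petal_of Phi x) x by apply/petal_ofE.
have /sub : petal (petal_of Phi x) y by apply/petal_ofE.
by rewrite /= => -> ->.
Qed.

(** Two disjoint sets are never both big for a profile, so each of the three
    profiles rules out at most one of the four petals of the flower. *)
Lemma flower_petal_missed Psi (Phi : pseudoflower lam k)
    (P1 P2 P3 : set (set E)) :
  (0 < k)%N -> is_profile lam k P1 -> is_profile lam k P2 -> is_profile lam k P3 ->
  is_flower Psi -> concatenation Phi Psi ->
  exists W : set (petal_index Phi), let B := petal_of Phi @^-1` W in
    [/\ high lam k B, P1 B, P2 B & P3 B].
Proof.
move=> k0 p1 p2 p3 [/card_leP[g] flower] [f [fsub _]].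
(* Reduction modulo 4 makes the enumeration of four petals total on nat. *)
pose u m : `I_4 := SigSub (mem_set (ltn_pmod m (isT : 0 < 4)%N : `I_4 (m %% 4))).
pose h m : petal_index Psi := val (g (u m)).
have hne m n : (m < 4)%N -> (n < 4)%N -> m <> n -> h m <> h n.
  move=> m4 n4 mn /val_inj/(inj (in_setT _) (in_setT _))/(congr1 val) /=.
  by rewrite !modn_small.
have fE x : petal_of Psi x = f (petal_of Phi x).
  by apply/petal_ofE; apply: fsub; apply/petal_ofE.
pose W m := f @^-1` [set h m].
have BE m : petal_of Phi @^-1` (W m) = petal_union [set h m].
  by rewrite petal_unionE predeqE => x; rewrite /W /preimage /= fE.
have hB m : (m < 4)%N -> lam (petal_of Phi @^-1` (W m)) = Some k.-1.
  move=> m4; rewrite BE; apply: flower; first by move=> x z -> ->.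
  split=> [e|e].
    by have : [set h m] (h m) by []; rewrite e.
  have [n n4 mn] : exists2 n, (n < 4)%N & n <> m.
    by exists (m == 0 : nat); case: m m4 {e}.
  have : [set h m] (h n) by rewrite e.
  exact: (hne n m).
have lB m : (m < 4)%N -> low lam k (petal_of Phi @^-1` (W m)).
  by move=> m4; rewrite /low hB //= leqnn.
have one P m n : is_profile lam k P -> (m < 4)%N -> (n < 4)%N -> m <> n ->
    P (petal_of Phi @^-1` (W m)) \/ P (petal_of Phi @^-1` (W n)).
  move=> pP m4 n4 mn; have [Pn|nPn] := EM (P (petal_of Phi @^-1` (W n))).
    by right.
  left; have := nPn; rewrite -(profile_setC k0 pP (lB n n4)).
  apply: (profile_subset k0 pP (lB m m4)) => x /= xm xn.
  by apply: (hne m n) => //; rewrite -xm -xn.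
pose good m := [/\ P1 (petal_of Phi @^-1` (W m)), P2 (petal_of Phi @^-1` (W m))
  & P3 (petal_of Phi @^-1` (W m))].
suff [m m4 [m1 m2 m3]] : exists2 m, (m < 4)%N & good m.
  by exists (W m); split=> //; rewrite /high hB //= leqnn.
have bad P : is_profile lam k P -> exists m, forall n, (n < 4)%N -> n <> m ->
    P (petal_of Phi @^-1` (W n)).
  move=> pP.
  have [[m [m4 mP]]|none] := EM (exists m, (m < 4)%N /\ ~ P (petal_of Phi @^-1` (W m))).
    by exists m => n n4 nm; case: (one P n m).
  exists 0 => n n4 _; apply: contrapT => nP; apply: none; by exists n.
have [m1 M1] := bad _ p1; have [m2 M2] := bad _ p2; have [m3 M3] := bad _ p3.
have [m m4 /and3P[/eqP n1 /eqP n2 /eqP n3]] :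
    exists2 m, (m < 4)%N & [&& m != m1, m != m2 & m != m3].
  have : has (fun m => m \notin [:: m1; m2; m3]) (iota 0 4).
    apply/negPn/negP => /hasPn sub.
    have := @uniq_leq_size _ (iota 0 4) [:: m1; m2; m3] (iota_uniq _ _).
    by move=> /(_ (fun x xs => negbNE (sub x xs))).
  case/hasP => m; rewrite mem_iota => /andP[_ m4].
  by rewrite !inE !negb_or => ?; exists m.
by exists m => //; split; [apply: M1|apply: M2|apply: M3].
Qed.
End PetalMap.

(** * Separating profiles by unions of petals *)

Section PetalUnions.
Variables (E : Type) (lam : connectivity_system E) (k : nat).
Hypothesis k_gt0 : (0 < k)%N.
Variables (I : Type) (pi : E -> I).
Hypothesis pi_low : forall Y : set I, low lam k (pi @^-1` Y).
Implicit Types (P Q : set (set E)) (Y : set I).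

Definition separated P Q := exists Y, ~ (P (pi @^-1` Y) <-> Q (pi @^-1` Y)).

Lemma separated_sym P Q : separated P Q -> separated Q P.
Proof. by case=> Y h; exists Y; tauto. Qed.

Lemma not_separated P Q : ~ separated P Q ->
  forall Y, P (pi @^-1` Y) <-> Q (pi @^-1` Y).
Proof. by move=> nPQ Y; apply: contrapT => h; apply: nPQ; exists Y. Qed.

Lemma separated_trans P Q Q' : ~ separated P Q -> separated Q Q' ->
  separated P Q'.
Proof. by move=> nPQ [Y hY]; exists Y; have := not_separated nPQ Y; tauto. Qed.

Lemma separated_big P Q : is_profile lam k P -> is_profile lam k Q ->
  separated P Q -> exists Y, ~ P (pi @^-1` Y) /\ Q (pi @^-1` Y).
Proof.
move=> pP pQ [Y hY].
have := (profile_setC k_gt0 pP (pi_low Y), profile_setC k_gt0 pQ (pi_low Y)).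
have [QY|nQY] := EM (Q (pi @^-1` Y)) => -[hP hQ]; first by exists Y; tauto.
by exists (~` Y); rewrite -preimage_setC; tauto.
Qed.

(** An ultrafilter is a Boolean homomorphism to a two-element algebra, and
    symmetric difference is its addition. *)
Lemma profile_symdiff P Y Z : is_profile lam k P ->
  P (pi @^-1` ((Y `\` Z) `|` (Z `\` Y))) <->
  (P (pi @^-1` Y) <-> P (pi @^-1` Z)).
Proof.
move=> pP; set D := (Y `\` Z) `|` (Z `\` Y).
have sub X X' : X `<=` X' -> P (pi @^-1` X') -> P (pi @^-1` X).
  by move=> XX'; apply: (profile_subset k_gt0 pP (pi_low X)) => x /XX'.
have setC X : P (pi @^-1` (~` X)) <-> ~ P (pi @^-1` X).
  by rewrite -preimage_setC; apply: (profile_setC k_gt0 pP).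
have setU X X' : P (pi @^-1` X) -> P (pi @^-1` X') -> P (pi @^-1` (X `|` X')).
  exact: (profile_setU k_gt0 pP (pi_low (X `|` X'))).
have [PY|nPY] := EM (P (pi @^-1` Y)); have [PZ|nPZ] := EM (P (pi @^-1` Z)).
- split=> // _; apply: sub (setU _ _ PY PZ).
  by move=> i [[]|[]]; [left|right].
- split=> [PD|]; last by tauto.
  case: nPZ; apply: sub (setU _ _ PY PD) => i Zi.
  by have [Yi|nYi] := EM (Y i); [left|right; right].
- split=> [PD|]; last by tauto.
  case: nPY; apply: sub (setU _ _ PZ PD) => i Yi.
  by have [Zi|nZi] := EM (Z i); [left|right; left].
- split=> // _.
  have := setU _ _ ((setC Y).2 nPY) ((setC Z).2 nPZ).
  by apply: sub => i [[Yi nZi]|[Zi nYi]]; [right|left].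
Qed.

End PetalUnions.

(** * A maximal strong pseudoanemone admits no crossing set *)

Section MaximalPseudoanemone.
Variables (E : Type) (lam : connectivity_system E) (k : nat).
Hypothesis k_gt0 : (0 < k)%N.
Variable Phi : pseudoflower lam k.
Hypothesis maxPhi : maximal_strong_pseudoanemone (@le_A E lam k) Phi.
Local Notation pi := (petal_of Phi).

Lemma maximal_no_crossing_set W S P Q P1 P2 :
  corner_config lam k pi W S P Q P1 P2 ->
  separated pi P P1 -> separated pi P P2 -> False.
Proof.
move=> cfg; have [[pP pQ p1 p2] _ lA agr [PS QS _ _] lS _ _ [wP w1 w2]] := cfg.
move=> /(separated_big k_gt0 lA pP p1)[Y1 [PY1 Y11]].
move=> /(separated_big k_gt0 lA pP p2)[Y2 [PY2 Y22]].
pose X0 := Y1 `&` Y2 `\` W.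
have PX0 : ~ P (pi @^-1` X0).
  apply: (profile_setI k_gt0 pP (lA (Y1 `&` Y2)) (lA (~` W))).
    exact: (profile_setI k_gt0 pP (lA Y1) (lA Y2)).
  by move=> /(profile_setC k_gt0 pP (lA W)).
(* Either the ultrafilter of P is generated by some i, and X contains at most
   that index, or no petal at all is big for P. *)
have [X [XX0 PX only]] : exists X, [/\ X `<=` X0, ~ P (pi @^-1` X) &
    forall j, X j -> forall i, i <> j -> P (pi @^-1` [set i])].
  have [[i Pi]|none] := EM (exists i, ~ P (pi @^-1` [set i])); last first.
    exists X0; split=> // j _ i _; apply: contrapT => Pi; apply: none.
    by exists i.
  exists (X0 `&` [set i]); split.
  - by move=> ? [].
  - exact: (profile_setI k_gt0 pP (lA X0) (lA [set i])).
  - move=> j [_ ->] i' ii'.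
    apply: (profile_subset k_gt0 pP (lA [set i']) (V := ~` (pi @^-1` [set i]))).
      by move=> x; rewrite /preimage /setC /= => ->.
    exact/(profile_setC k_gt0 pP (lA [set i])).
have aX : apt pi W P P1 P2 X.
  split=> //.
  - by apply: (profile_subset k_gt0 p1 (lA X)) Y11 => x /XX0[[]].
  - by apply: (profile_subset k_gt0 p2 (lA X)) Y22 => x /XX0[[]].
  - by apply/seteqP; split=> // i [/XX0[]].
(* Otherwise splitting the petal j along S would refine Phi: the new index None
   stands for the part inside S. *)
have one_side j x y : X j -> pi x = j -> pi y = j -> S x -> S y.
  move=> Xj xj yj Sx; apply: contrapT => nSy.
  pose q z := if `[< pi z = j /\ S z >] then None else Some (pi z).
  have qx : q x = None by rewrite /q; case: asboolP => // -[].
  have qy : q y = Some j by rewrite /q yj; case: asboolP => // -[].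
  have qsurj o : exists z, q z = o.
    case: o => [i|]; last by exists x.
    have [->|ij] := EM (i = j); first by exists y.
    have [z /petal_ofE zi] := petal_nonempty i; exists z.
    by rewrite /q zi; case: asboolP => // -[].
  have corner_low Z : ~ Z j -> low lam k (corner pi S [set j] Z).
    by move=> nZj; apply: (low_corner_petal k_gt0 cfg aX) => //; apply: only.
  have qfine z w : q z = q w -> pi z = pi w.
    rewrite /q; case: asboolP => [[zj _]|_]; case: asboolP => [[wj _]|_] //.
      by rewrite zj wj.
    by case.
  have qlow (Y : set (option _)) : low lam k (q @^-1` Y).
    pose Z := [set i | Y (Some i)].
    have qY z : (q @^-1` Y) z =
        ((pi z = j /\ S z) /\ Y None \/ ~ (pi z = j /\ S z) /\ Z (pi z)).
      rewrite /q /preimage /Z /=; apply/propext.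
      by case: asboolP => h; tauto.
    have [YN|nYN] := EM (Y None); have [Zj|nZj] := EM (Z j).
    - rewrite (_ : _ @^-1` _ = pi @^-1` Z) //.
      rewrite predeqE => z; rewrite qY /preimage /=.
      by have [->|] := EM (pi z = j); have := EM (S z); tauto.
    - rewrite (_ : _ @^-1` _ = corner pi S [set j] Z); first exact: corner_low.
      rewrite predeqE => z; rewrite qY /corner; unfold_sets.
      by have [->|] := EM (pi z = j); have := EM (S z); tauto.
    - rewrite -lowC (_ : ~` _ = corner pi S [set j] (~` Z)).
        by apply: corner_low => /(_ Zj).
      rewrite predeqE => z; rewrite {1}/setC /mkset qY /corner; unfold_sets.
      by have [->|] := EM (pi z = j); have := EM (S z); tauto.
    - rewrite (_ : _ @^-1` _ = pi @^-1` Z) //.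
      rewrite predeqE => z; rewrite qY /preimage /=.
      by have [->|] := EM (pi z = j); have := EM (S z); tauto.
  have := maximal_not_refinable maxPhi qsurj qlow qfine (x := x) (y := y).
  by rewrite xj yj qx qy => /(_ erefl).
pose Y := X `&` [set j | exists2 x, pi x = j & S x].
have YE : pi @^-1` Y = pi @^-1` X `&` S.
  rewrite predeqE => x; split=> [[Xx [y yx Sy]]|[Xx Sx]].
    by split=> //; apply: (one_side (pi x) y x).
  by split=> //; exists x.
have PY : ~ P (pi @^-1` Y) by rewrite YE; apply: (profile_setI k_gt0 pP).
apply: PY; apply/agr.
by apply: (profile_subset k_gt0 pQ (lA Y)) QS; rewrite YE => x [].
Qed.

End MaximalPseudoanemone.

Theorem lemma7p14 (E : Type) (lam : connectivity_system E) (k : nat)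
  (hk : (1 <= k)%N)
  (PP : set (set (set E)))
  (hPP : forall P, PP P -> is_profile lam k P)
  (htrunc : forall P Q, PP P -> PP Q ->
     truncation lam k.-1 P = truncation lam k.-1 Q)
  (Phi : pseudoflower lam k)
  (hmax : maximal_strong_pseudoanemone (@le_A E lam k) Phi)
  (hanemone : exists Psi : pseudoflower lam k,
     concatenation Phi Psi /\ is_anemone Psi)
  (hthree : distinguishes_three PP Phi) :
  maximal_strong_pseudoanemone (preceq_A PP) Phi.
Proof.
have PhiL (Y : set (petal_index Phi)) : low lam k (petal_of Phi @^-1` Y).
  by rewrite -petal_unionE; apply: (hmax.1).
split; first exact: hmax.1.
move=> Psi Psi_strong PhiPsi P Q hP hQ [S0 [Y0 ->] dS0].
have PsiL (Y : set (petal_index Psi)) : low lam k (petal_of Psi @^-1` Y).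
  by rewrite -petal_unionE; apply: Psi_strong.
have sep_of P1 P2 S : PP P1 -> PP P2 -> is_petal_union Phi S ->
    distinguishes S P1 P2 -> separated (petal_of Phi) P1 P2.
  move=> h1 h2 [Y ->]; rewrite petal_unionE.
  by move=> /(distinguishesE hk (hPP _ h1) (hPP _ h2) (PhiL Y)); exists Y.
apply: contrapT => noPhi.
have nPQ : ~ separated (petal_of Phi) P Q.
  case=> Y hY; apply: noPhi; exists (petal_union Y); first by exists Y.
  rewrite petal_unionE.
  exact/(distinguishesE hk (hPP _ hP) (hPP _ hQ) (PhiL Y)).
have [P1 [P2 [[h1 h2] s1 s2 s12]]] : exists P1 P2, [/\ PP P1 /\ PP P2,
    separated (petal_of Phi) P P1, separated (petal_of Phi) P P2
  & separated (petal_of Phi) P1 P2].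
  have [P1 [P2 [P3 [[h1 h2 h3] [d12 d13 d23]]]]] := hthree.
  have disp S : displayed Phi S -> is_petal_union Phi S.
    by move=> [Y [_ _ ->]]; exists Y.
  have s12 : separated (petal_of Phi) P1 P2 by case: d12 => S /disp; apply: sep_of.
  have s13 : separated (petal_of Phi) P1 P3 by case: d13 => S /disp; apply: sep_of.
  have s23 : separated (petal_of Phi) P2 P3 by case: d23 => S /disp; apply: sep_of.
  have [s1|n1] := EM (separated (petal_of Phi) P P1); last first.
    by exists P2, P3; split=> //; apply: separated_trans n1 _.
  have [s2|n2] := EM (separated (petal_of Phi) P P2); first by exists P1, P2.
  exists P1, P3; split=> //; exact: separated_trans n2 _.
have [p p' p1 p2] : [/\ is_profile lam k P, is_profile lam k Q,
  is_profile lam k P1 & is_profile lam k P2] by split; apply: hPP.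
have [Psi0 [conc [flower _]]] := hanemone.
have [W [hW wP w1 w2]] := flower_petal_missed hk p p1 p2 flower conc.
have cross R1 R2 S : PP R1 -> PP R2 -> separated (petal_of Phi) P R1 ->
    separated (petal_of Phi) P R2 -> separated (petal_of Phi) R1 R2 ->
    R1 (petal_of Phi @^-1` W) -> R2 (petal_of Phi @^-1` W) ->
    low lam k S -> [/\ ~ P S, Q S, R1 S & ~ R2 S] -> False.
  move=> r1 r2 t1 t2 t12 W1 W2 lS xS.
  apply: (@maximal_no_crossing_set E lam k hk Phi hmax W S P Q R1 R2) => //.
  split=> //.
  - by split; apply: hPP.
  - by split; [|split]; apply: htrunc.
  - exact: not_separated.
  - have [Y] := separated_big hk PhiL (hPP _ r2) (hPP _ r1) (separated_sym t12).
    by exists Y; tauto.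
have cross2 S : low lam k S -> ~ P S -> Q S -> ~ (P1 S <-> P2 S) -> False.
  move=> lS PS QS; have [P1S|nP1S] := EM (P1 S) => ne.
    by apply: (cross P1 P2 S) => //; split=> //; tauto.
  apply: (cross P2 P1 S) => //; first exact: separated_sym.
  by split=> //; apply: contrapT; tauto.
have uncrossed S : low lam k S -> ~ (P S <-> Q S) -> P1 S <-> P2 S.
  move=> lS ne; apply: contrapT => ne12.
  have [PS|nPS] := EM (P S); last first.
    by apply: (cross2 S) => //; apply: contrapT; tauto.
  have := (profile_setC hk p lS, profile_setC hk p' lS,
           profile_setC hk p1 lS, profile_setC hk p2 lS).
  by case=> -[[] ? ? ? ?]; apply: (cross2 (~` S)); rewrite ?lowC //; tauto.
have [S1 [Y1 ->]] : exists2 S, is_petal_union Psi S & distinguishes S P1 P2.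
  apply: PhiPsi => //; have [Y hY] := s12.
  exists (petal_union Y); first by exists Y.
  by rewrite petal_unionE; apply/(distinguishesE hk p1 p2 (PhiL Y)).
move: dS0; rewrite !petal_unionE.
move=> /(distinguishesE hk p p' (PsiL Y0)) n0.
move=> /(distinguishesE hk p1 p2 (PsiL Y1)) n1.
(* If neither Y0 nor Y1 gives a set separating both pairs, then their symmetric
   difference does. *)
pose D := (Y0 `\` Y1) `|` (Y1 `\` Y0).
have u0 := uncrossed _ (PsiL Y0); have u1 := uncrossed _ (PsiL Y1).
have uD := uncrossed _ (PsiL D).
have := (profile_symdiff hk PsiL Y0 Y1 p, profile_symdiff hk PsiL Y0 Y1 p',
         profile_symdiff hk PsiL Y0 Y1 p1, profile_symdiff hk PsiL Y0 Y1 p2).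
case=> -[[] dP dQ d1 d2].
have [a|a] := EM (P (petal_of Psi @^-1` Y1) <-> Q (petal_of Psi @^-1` Y1));
  last by tauto.
by move: (u0 n0) uD; rewrite /D dP dQ d1 d2; tauto.
Qed.
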